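(* Let $d\ge 1$, let $\mathbf m=(m_1,\dots,m_d)\in\mathbb N^d$ and let $U\subseteq P(d,\mathbf m)$ be a color-squarefree monomial order ideal. Then the balanced squeezed complex $\Delta_{\mathrm{bal}}(U)$ is vertex-decomposable, and in particular shellable. In particular, if $m_i=0$ for all $1\le i\le d$, then $\Delta_{\mathrm{bal}}(U)$ is a $(d-1)$-simplex. Otherwise, any vertex $1^{(i)}$ with $m_i\ge 1$ can be taken as a shedding vertex.
   Context: Here $\mathbb N$ contains $0$. $P(d,\mathbf m)$ is the polynomial ring over a field $\mathbb K$ in variables $x_{i,j}$, $1\le i\le d$, $1\le j\le m_i$; $x_{i,j}$ has color $i$. A monomial is color-squarefree if it is squarefree and divisible by at most one variable of each color; $\mathrm{Mon}_{\mathrm{c\text{-}sqfree}}(d,\mathbf m)$ is the set of all such monomials. A color-squarefree monomial order ideal is a set $U\subseteq \mathrm{Mon}_{\mathrm{c\text{-}sqfree}}(d,\mathbf m)$ closed under taking divisors; throughout, it is assumed to contain $1$ and all variables $x_{i,j}$ of $P(d,\mathbf m)$. Balanced squeezed complex: let $V_i=\{1^{(i)},\dots,(m_i+1)^{(i)}\}$. For $u=x_{i_1,j_1}\cdots x_{i_s,j_s}$ color-squarefree with $i_1<\dots<i_s$ put $F_d(u)=\{j_1^{(i_1)},\dots,j_s^{(i_s)}\}\cup\{(m_j+1)^{(j)} : j\in[d]\setminus\{i_1,\dots,i_s\}\}\subseteq\bigcup_i V_i$. Then $\Delta_{\mathrm{bal}}(U)$ is the simplicial complex whose facets are the sets $F_d(u)$,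 $u\in U$. For a simplicial complex $\Delta$ and vertex $v$: $\mathrm{lk}_\Delta(v)=\{G\in\Delta: v\notin G,\ G\cup\{v\}\in\Delta\}$ and $\Delta\setminus\{v\}=\{G\in\Delta: v\notin G\}$. A pure simplicial complex $\Delta$ is vertex-decomposable if either $\Delta=\{\emptyset\}$ or there is a vertex $v\in\Delta$ (a shedding vertex) such that $\mathrm{lk}_\Delta(v)$ and $\Delta\setminus\{v\}$ are (pure and) vertex-decomposable. A pure complex is shellable if its facets can be ordered $F_1,\dots,F_n$ such that for each $1<i\le n$ the complex $\langle F_i\rangle\cap\bigcup_{j<i}\langle F_j\rangle$ is generated by a non-empty set of maximal proper faces of $\langle F_i\rangle$, where $\langle F\rangle$ is the set of all subsets of $F$. *)

(* Defs.v *)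
From mathcomp Require Import all_boot finmap.
From mathcomp.multinomials Require Import monalg.

Set Implicit Arguments.
Unset Strict Implicit.
Unset Printing Implicit Defensive.

Section SimplicialComplexes.
Variable T : finType.
Implicit Types (D : {set {set T}}) (F G : {set T}) (v : T).

Definition simplicial_complex D :=
  set0 \in D /\ forall F G, F \in D -> G \subset F -> G \in D.

Definition facets D : {set {set T}} := [set F | maxset [in D] F].

Definition pure D :=
  forall F G, F \in facets D -> G \in facets D -> #|F| = #|G|.

Definition is_simplex (k : nat) D :=
  exists2 F : {set T}, #|F| = k.+1 & D = powerset F.

Definition is_vertex D v := [set v] \in D.

Definition link D v : {set {set T}} :=
  [set G in D | (v \notin G) && (v |: G \in D)].

Definition deletion D v : {set {set T}} := [set G in D | v \notin G].

Inductive vertex_decomposable : {set {set T}} -> Prop :=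
| VD_empty_face : vertex_decomposable [set set0]
| VD_shedding D v :
    simplicial_complex D -> pure D -> is_vertex D v ->
    vertex_decomposable (link D v) -> vertex_decomposable (deletion D v) ->
    vertex_decomposable D.

(* Purity of the link and of the deletion is part of [vertex_decomposable]. *)
Definition shedding_vertex D v :=
  [/\ is_vertex D v, vertex_decomposable (link D v)
    & vertex_decomposable (deletion D v)].

Definition max_proper_faces F : {set {set T}} :=
  [set G | maxset (fun H => H \proper F) G].

(* The subcomplex <F> is [powerset F]. *)
Definition shelling (s : seq {set T}) :=
  forall i, 0 < i < size s ->
  exists E : {set {set T}},
    [/\ E != set0, E \subset max_proper_faces (nth set0 s i)
      & powerset (nth set0 s i) :&: \bigcup_(F <- take i s) powerset F
        = \bigcup_(G in E) powerset G].

Definition shellable D :=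
  [/\ simplicial_complex D, pure D
    & exists s : seq {set T}, [/\ uniq s, s =i facets D & shelling s]].

End SimplicialComplexes.

Section BalancedSqueezed.
Variables (d : nat) (m : 'I_d -> nat).

(* Colors, and indices within a color, are numbered from 0: the pair (i, j)
   of [var] is x_{i+1,j+1} and the pair (i, j) of [vert] is (j+1)^(i+1). *)
Definition var := {i : 'I_d & 'I_(m i)}.
Definition vert := {i : 'I_d & 'I_(m i).+1}.

Definition color (x : var) : 'I_d := tag x.

Definition vert_of_var (x : var) : vert :=
  Tagged (fun i => 'I_(m i).+1) (widen_ord (leqnSn (m (color x))) (tagged x)).

Definition first_vert (i : 'I_d) : vert :=
  Tagged (fun i => 'I_(m i).+1) (@ord0 (m i)).

Definition last_vert (i : 'I_d) : vert :=
  Tagged (fun i => 'I_(m i).+1) (@ord_max (m i)).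

(* [{cmonom var}] is the monoid of monomials of P(d,m), over any field;
   [u x] is the exponent of the variable x in u. *)
Implicit Types (u v w : {cmonom var}) (U : {fset {cmonom var}}).

Definition divides v u := exists w, u = mmul v w.

Definition color_squarefree u :=
  (forall x : var, u x <= 1) /\
  (forall x y : var, 0 < u x -> 0 < u y -> color x = color y -> x = y).

(* The set of color-squarefree monomials is finite, so that finite sets of
   monomials account for all its subsets. *)
Definition cs_order_ideal U :=
  [/\ forall u, u \in U -> color_squarefree u,
      forall u v, u \in U -> divides v u -> v \in U,
      mone \in U
    & forall x : var, ucm x \in U].

Definition bal_facet u : {set vert} :=
  [set vert_of_var x | x : var & 0 < u x]
    :|: [set last_vert i | i : 'I_d & [forall x, (0 < u x) ==> (color x != i)]].

Definition bal_complex U : {set {set vert}} :=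
  [set G : {set vert} | has (fun u => G \subset bal_facet u) (enum_fset U)].

Lemma card_bal_facet u : color_squarefree u -> #|bal_facet u| = d.
Proof.
move=> [_ colP].
have sum_tag (G : {set vert}) : (forall i, exists! p : vert, p \in G /\ tag p = i) ->
    #|G| = d.
  move=> uniqG; rewrite -[RHS]card_ord -cardsT.
  have <- : tag @: G = [set: 'I_d].
    apply/setP=> i; rewrite inE; have [v [[vG <-] _]] := uniqG i.
    exact: imset_f.
  rewrite card_in_imset // => v w vG wG tagE.
  have [z [_ zP]] := uniqG (tag w).
  by rewrite -(zP v) // -(zP w).
apply: sum_tag => i.
have [/forallP no_i | /forallPn[x]] :=
    boolP [forall x, (0 < u x) ==> (color x != i)].
  exists (last_vert i); split.
    split=> //; rewrite inE; apply/orP; right.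
    by apply/imsetP; exists i => //; rewrite inE; apply/forallP.
  move=> v []; rewrite inE => /orP[] /imsetP[].
    move=> y; rewrite inE => uy -> yi.
    by have := no_i y; rewrite uy -yi /color /= eqxx.
  by move=> j _ -> /= ->.
rewrite negb_imply negbK => /andP[ux /eqP xi].
exists (vert_of_var x); split.
  by split=> //; rewrite inE; apply/orP; left; apply: imset_f; rewrite inE.
move=> v []; rewrite inE => /orP[] /imsetP[].
  move=> y; rewrite inE => uy -> yi.
  by congr vert_of_var; apply: colP => //; rewrite xi -yi.
move=> j; rewrite inE => /forallP/(_ x); rewrite ux /= => /eqP xj -> /= ji.
by case: xj; rewrite xi.
Qed.

Lemma facets_bal_complex U (F : {set vert}) : cs_order_ideal U ->
  F \in facets (bal_complex U) <-> exists2 u, u \in U & F = bal_facet u.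
Proof.
move=> [sqU _ _ _]; rewrite inE; split.
  case/maxsetP; rewrite inE => /hasP[u uU sFu] maxF.
  exists u => //; apply/esym/maxF => //.
  by rewrite inE; apply/hasP; exists u.
case=> u uU ->; apply/maxsetP; split.
  by rewrite inE; apply/hasP; exists u.
move=> G; rewrite inE => /hasP[w wU sGw] suG.
apply/eqP; rewrite eq_sym eqEcard suG /= (card_bal_facet (sqU _ uU)).
have := subset_leq_card sGw.
by rewrite (card_bal_facet (sqU _ wU)).
Qed.

End BalancedSqueezed.

(* Main.v *)
Require Import Defs.
From mathcomp Require Import all_boot finmap.
From mathcomp.multinomials Require Import monalg.

Set Implicit Arguments.
Unset Strict Implicit.
Unset Printing Implicit Defensive.

(** The order ideal matters only through the supports of its monomials.  Read
    as sets of vertices, these supports form a family I of partial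
    transversals of the color classes (at most one vertex of each color, never
    the last one), closed under removing an element; the facet of a
    transversal A is its [completion], the union of A and the last vertices of
    the colors which A misses.

    The point of allowing an arbitrary set K of active colors is that this
    class of complexes is stable under both operations of
    vertex-decomposability.  Let v belong to some member of I.  The link of v
    is the complex of the family of all A \ v with v in A, on the colors other
    than that of v ([link_squeezed]).  The deletion of v is the complex of the
    members of I which avoid v, on the same colors ([deletion_squeezed]):
    when v is in A, what remains of the facet of A lies in the facet of A \ v,
    whose last vertex of the color of v takes the place of v.  Both families
    are smaller than I, so that an induction on the cardinal of I applies; it
    stops when I contains only the empty transversal, and the complex is then a
    simplex.  For the supports of U, every non-last vertex lies in a member of
    I, because U contains all variables; hence it is a shedding vertex.

    Listing the facets by increasing cardinal of A gives a shelling
    ([shelling_squeezed]).  If B comes before A, some v in A is not in B, and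
    since v is not a last vertex it is not in the facet of B either; so the two
    facets meet inside the facet of A minus v, which is contained in the
    earlier facet of A \ v. *)

(** * Simplices and maximal proper faces *)

Section Simplices.
Variable T : finType.
Implicit Types (F G : {set T}) (v : T).

Lemma facets_powerset F : facets (powerset F) = [set F].
Proof.
apply/setP=> G; rewrite !inE; apply/idP/eqP => [/maxsetP[] | ->].
  by rewrite powersetE => sGF /(_ F) -> //; rewrite inE.
apply/maxsetP; split; first by rewrite inE.
by move=> H; rewrite powersetE => sHF sFH; apply/eqP; rewrite eqEsubset sHF.
Qed.

Lemma link_powerset F v : v \in F -> link (powerset F) v = powerset (F :\ v).
Proof.
move=> vF; apply/setP=> G; rewrite !inE subUset sub1set vF subsetD1 /=.
by case: (G \subset F); rewrite ?andbT.
Qed.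

Lemma deletion_powerset F v : deletion (powerset F) v = powerset (F :\ v).
Proof. by apply/setP=> G; rewrite !inE subsetD1. Qed.

(** Every vertex of a simplex is shedding: its link and its deletion are the
    same smaller simplex. *)
Lemma vertex_decomposable_powerset F : vertex_decomposable (powerset F).
Proof.
have [n] := ubnP #|F|; elim: n F => // n IHn F leFn.
have [-> | [v vF]] := set_0Vmem F; first by rewrite powerset0; left.
have vdFv : vertex_decomposable (powerset (F :\ v)).
  by apply: IHn; apply: leq_trans (proper_card (properD1 vF)) _.
apply: (@VD_shedding _ _ v).
- split=> [|G H]; rewrite !powersetE ?sub0set // => sGF sHG.
  exact: subset_trans sGF.
- by move=> G H; rewrite facets_powerset !inE => /eqP-> /eqP->.
- by rewrite /is_vertex powersetE sub1set.
- by rewrite link_powerset.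
- by rewrite deletion_powerset.
Qed.

Lemma max_proper_face_setD1 F v : v \in F -> F :\ v \in max_proper_faces F.
Proof.
move=> vF; rewrite inE; apply/maxsetP; split=> [|H ltHF sFvH].
  exact: properD1.
apply/eqP; rewrite eq_sym eqEcard sFvH /=.
by have := proper_card ltHF; rewrite (cardsD1 v F) vF.
Qed.

End Simplices.

(** * Complexes of completed partial transversals *)

Section Squeezed.
Variables (T C : finType) (c : T -> C) (z : C -> T).
Hypothesis zK : cancel z c.
Implicit Types (K : {set C}) (A B G : {set T}) (I : {set {set T}}) (v : T).

(** The sets are supports of color-squarefree monomials in the variables whose
    color lies in K.  Since z k stands for the last vertex of color k, which is
    no variable, no member contains it.  Nothing forces a given vertex to
    belong to some member: the link of a vertex may lose variables. *)
Definition transversal_ideal K I :=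
  [/\ I != set0,
      {in I, forall A v, v \in A -> A :\ v \in I},
      {in I, forall A, {in A &, injective c} /\ c @: A \subset K}
    & {in I, forall A k, z k \notin A}].

Definition completion K A := A :|: z @: (K :\: c @: A).

Definition squeezed K I : {set {set T}} :=
  [set G : {set T} | [exists A in I, G \subset completion K A]].

Lemma squeezedP K I G :
  reflect (exists2 A, A \in I & G \subset completion K A) (G \in squeezed K I).
Proof. by rewrite inE; apply: exists_inP. Qed.

Lemma sub_completion K A : A \subset completion K A.
Proof. exact: subsetUl. Qed.

(** Removing v from A can only enlarge the set of missing colors. *)
Lemma completion_setD1 K A v :
  completion K A :\ v \subset completion K (A :\ v).
Proof.
rewrite setDUl setUSS // (subset_trans (subsetDl _ _)) //.
by rewrite imsetS // setDS // imsetS // subsetDl.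
Qed.

Section Ideal.
Variables (K : {set C}) (I : {set {set T}}).
Hypothesis idealI : transversal_ideal K I.

Lemma completion_in_squeezed A : A \in I -> completion K A \in squeezed K I.
Proof. by move=> AI; apply/squeezedP; exists A. Qed.

(** The vertices added by a completion are last vertices, so a completion gains
    no vertex that occurs in a transversal. *)
Lemma mem_completion A B v :
  A \in I -> B \in I -> v \in A -> (v \in completion K B) = (v \in B).
Proof.
case: idealI => _ _ _ noz AI BI vA; rewrite inE orbC.
have [/imsetP[k _ vE] | //] := boolP (v \in _ @: _).
by have := noz A AI k; rewrite -vE vA.
Qed.

Lemma completion_inj : {in I &, injective (completion K)}.
Proof.
have sub A B : A \in I -> B \in I -> completion K A = completion K B ->
    A \subset B.
  move=> AI BI eqAB; apply/subsetP=> v vA.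
  by rewrite -(mem_completion AI BI vA) -eqAB (mem_completion AI AI vA).
by move=> A B AI BI eqAB; apply/eqP; rewrite eqEsubset !sub.
Qed.

(** A completion has exactly one vertex of each active color. *)
Lemma card_completion A : A \in I -> #|completion K A| = #|K|.
Proof.
case: idealI => _ _ tr noz AI; have [injA sAK] := tr A AI.
rewrite cardsU (card_imset _ (can_inj zK)) cardsD (setIidPr sAK).
rewrite (card_in_imset injA).
have -> : A :&: z @: (K :\: c @: A) = set0.
  apply/setP=> v; rewrite !inE; apply/andP=> -[vA /imsetP[k _ vE]].
  by have := noz A AI k; rewrite -vE vA.
rewrite cards0 subn0 subnKC //.
by rewrite -(card_in_imset injA) subset_leq_card.
Qed.

(** As all completions have the same cardinal, none lies properly in another. *)
Lemma facets_squeezed : facets (squeezed K I) = completion K @: I.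
Proof.
apply/setP=> F; rewrite inE; apply/maxsetP/imsetP => [[] | [A AI ->]].
  move=> /squeezedP[A AI sFA] maxF; exists A => //.
  by apply/esym/maxF => //; apply: completion_in_squeezed.
split=> [|G /squeezedP[B BI sGB] sAG]; first exact: completion_in_squeezed.
apply/eqP; rewrite eq_sym eqEcard sAG card_completion //.
by rewrite -(card_completion BI) subset_leq_card.
Qed.

Lemma pure_squeezed : pure (squeezed K I).
Proof.
move=> F G; rewrite facets_squeezed => /imsetP[A AI ->] /imsetP[B BI ->].
by rewrite !card_completion.
Qed.

Lemma simplicial_complex_squeezed : simplicial_complex (squeezed K I).
Proof.
split=> [|F G /squeezedP[A AI sFA] sGF].
  have [/set0Pn[A AI] _ _ _] := idealI.
  by apply/squeezedP; exists A => //; apply: sub0set.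
by apply/squeezedP; exists A => //; apply: subset_trans sFA.
Qed.

Section Shedding.
Variables (v : T) (A0 : {set T}).
Hypotheses (A0I : A0 \in I) (vA0 : v \in A0).

Definition link_ideal : {set {set T}} := [set A :\ v | A in I & v \in A].
Definition deletion_ideal : {set {set T}} := [set A in I | v \notin A].

Lemma vertex_squeezed : is_vertex (squeezed K I) v.
Proof.
apply/squeezedP; exists A0 => //.
by rewrite sub1set (subsetP (sub_completion _ _)).
Qed.

Lemma transversal_deletion_ideal : transversal_ideal K deletion_ideal.
Proof.
have [_ clI tr noz] := idealI.
split=> [|A|A|A].
- by apply/set0Pn; exists (A0 :\ v); rewrite inE clI //= !inE eqxx.
- rewrite inE => /andP[AI vA] w wA.
  by rewrite inE clI //= in_setD1 negb_and vA orbT.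
- by rewrite inE => /andP[AI _]; apply: tr.
- by rewrite inE => /andP[AI _]; apply: noz.
Qed.

Lemma transversal_link_ideal : transversal_ideal (K :\ c v) link_ideal.
Proof.
have [_ clI tr noz] := idealI.
split=> [|_ /imsetP[A /setIdP[AI vA] ->]
         |_ /imsetP[A /setIdP[AI vA] ->]
         |_ /imsetP[A /setIdP[AI vA] ->] k].
- by apply/set0Pn; exists (A0 :\ v); apply: imset_f; rewrite inE A0I.
- move=> w /setD1P[wv wA]; apply/imsetP; exists (A :\ w).
    by rewrite inE clI //= in_setD1 eq_sym wv.
  by rewrite !setDDl setUC.
- have [injA sAK] := tr A AI; split.
    by move=> x y /setD1P[_ xA] /setD1P[_ yA]; apply: injA.
  apply/subsetP=> _ /imsetP[x /setD1P[xv xA] ->].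
  rewrite in_setD1 (subsetP sAK) ?imset_f // andbT.
  by apply: contra xv => /eqP eqc; apply/eqP/injA.
- by rewrite in_setD1 (negPf (noz A AI k)) andbF.
Qed.

Lemma card_deletion_ideal : #|deletion_ideal| < #|I|.
Proof.
apply: proper_card; apply/properP; split.
  by apply/subsetP=> A; rewrite inE => /andP[].
by exists A0 => //; rewrite inE vA0 andbF.
Qed.

(** The link is compared with the deletion: as the family is closed under
    removal, A \ v is itself a member avoiding v. *)
Lemma card_link_ideal : #|link_ideal| < #|I|.
Proof.
apply: leq_ltn_trans card_deletion_ideal; apply: subset_leq_card.
have [_ clI _ _] := idealI.
apply/subsetP=> _ /imsetP[A /setIdP[AI vA] ->].
by rewrite inE clI // !inE eqxx.
Qed.

(** Deleting v creates no new facet: a face of a completion of A that avoids v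
    is still covered when v is removed from A. *)
Lemma deletion_squeezed :
  deletion (squeezed K I) v = squeezed K deletion_ideal.
Proof.
have [_ clI _ _] := idealI.
apply/setP=> G; rewrite inE; apply/andP/squeezedP => [[] | [A]].
  move=> /squeezedP[A AI sGA] vG.
  have [vA | vA] := boolP (v \in A); last by exists A; rewrite // inE AI.
  exists (A :\ v); first by rewrite inE clI //= !inE eqxx.
  by apply: subset_trans (completion_setD1 K A v); rewrite subsetD1 sGA.
rewrite inE => /andP[AI vA] sGA; split; first by apply/squeezedP; exists A.
by apply: contra vA => /(subsetP sGA); rewrite (mem_completion A0I AI vA0).
Qed.

(** The color of v is no longer active, so the removal of v does not bring in
    the last vertex of that color. *)
Lemma completion_link A : A \in I -> v \in A ->
  completion (K :\ c v) (A :\ v) = completion K A :\ v.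
Proof.
have [_ _ tr noz] := idealI.
move=> AI vA; rewrite /completion setDUl; congr (_ :|: _).
have -> : (K :\ c v) :\: c @: (A :\ v) = K :\: c @: A.
  by rewrite setDDl -imset_set1 -imsetU setD1K.
apply/esym/setDidPl; rewrite disjoint_sym disjoints1.
apply/imsetP=> -[k _ vE].
by have := noz A AI k; rewrite -vE vA.
Qed.

Lemma link_squeezed :
  link (squeezed K I) v = squeezed (K :\ c v) link_ideal.
Proof.
apply/setP=> G; apply/setIdP/squeezedP => [[_ /andP[vG]] | ].
  case/squeezedP=> A AI; rewrite subUset sub1set => /andP[].
  rewrite (mem_completion A0I AI vA0) => vA sGA; exists (A :\ v).
    by apply: imset_f; rewrite inE AI.
  by rewrite completion_link // subsetD1 sGA.
case=> _ /imsetP[A /setIdP[AI vA] ->].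
rewrite completion_link // subsetD1 => /andP[sGA vG].
rewrite vG; split; apply/squeezedP; exists A => //.
by rewrite subUset sub1set sGA (mem_completion A0I AI vA0) vA.
Qed.

End Shedding.

End Ideal.

Lemma vertex_decomposable_squeezed K I :
  transversal_ideal K I -> vertex_decomposable (squeezed K I).
Proof.
have [n] := ubnP #|I|; elim: n K I => // n IHn K I ltIn idealI.
have [/existsP[A /andP[AI /set0Pn[v vA]]] | noA] :=
    boolP [exists A in I, A != set0].
  apply: (@VD_shedding _ _ v).
  - exact: simplicial_complex_squeezed idealI.
  - exact: pure_squeezed idealI.
  - exact: (vertex_squeezed _ AI vA).
  - rewrite (link_squeezed idealI AI vA); apply: IHn.
      exact: leq_trans (card_link_ideal idealI AI vA) _.
    exact: (transversal_link_ideal idealI AI vA).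
  - rewrite (deletion_squeezed idealI AI vA); apply: IHn.
      exact: leq_trans (card_deletion_ideal AI vA) _.
    exact: (transversal_deletion_ideal idealI AI vA).
have I0 A : A \in I -> A = set0.
  by move=> AI; apply/eqP; apply: contraR noA => nzA; apply/existsP; exists A;
     rewrite AI.
have -> : squeezed K I = powerset (completion K set0).
  have [/set0Pn[B BI] _ _ _] := idealI.
  apply/setP=> G; rewrite powersetE; apply/squeezedP/idP.
    by case=> A /I0 ->.
  by exists B; rewrite // (I0 B).
exact: vertex_decomposable_powerset.
Qed.

Lemma shedding_vertex_squeezed K I A v : transversal_ideal K I ->
  A \in I -> v \in A -> shedding_vertex (squeezed K I) v.
Proof.
move=> idealI AI vA; split; first exact: (vertex_squeezed _ AI vA).
  rewrite (link_squeezed idealI AI vA); apply: vertex_decomposable_squeezed.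
  exact: (transversal_link_ideal idealI AI vA).
rewrite (deletion_squeezed idealI AI vA); apply: vertex_decomposable_squeezed.
exact: (transversal_deletion_ideal idealI AI vA).
Qed.

(** Any order by increasing cardinal works; the intersection of the facet of A
    with the earlier ones is generated by the sets obtained from it by removing
    one element of A, the last vertices being never removed. *)
Lemma shelling_squeezed K I (s : seq {set T}) : transversal_ideal K I ->
    uniq s -> s =i I -> sorted (relpre (fun A => #|A|) leq) s ->
  shelling (map (completion K) s).
Proof.
move=> idealI uniq_s sI sort_s i; rewrite size_map => /andP[i_gt0 ltis].
have [_ clI _ _] := idealI.
have nthI j : j < size s -> nth set0 s j \in I.
  by move=> ltjs; rewrite -sI mem_nth.
set A := nth set0 s i; have AI : A \in I by apply: nthI.
have leT_tr : transitive (relpre (fun A : {set T} => #|A|) leq).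
  by move=> x y w; apply: leq_trans.
(* An earlier set is no larger than A and differs from it. *)
have earlierP B : B \in take i s -> exists2 v, v \in A & v \notin B.
  move=> Btake; have Bs := mem_take Btake.
  move: Btake; rewrite in_take // => ltBi.
  have leBA : #|B| <= #|A|.
    rewrite -(nth_index set0 Bs); apply: (sorted_leq_nth leT_tr) => //.
    - by move=> x /=.
    - by rewrite inE (ltn_trans ltBi).
    - exact: ltnW.
  apply/subsetPn; apply: contraL ltBi => sAB.
  have -> : B = A by apply/esym/eqP; rewrite eqEcard sAB.
  by rewrite index_uniq // ltnn.
(* The sort key of A \ v is strictly smaller, so it cannot come after A. *)
have setD1_earlier v : v \in A -> A :\ v \in take i s.
  move=> vA; have Avs : A :\ v \in s by rewrite sI clI.
  rewrite in_take // ltnNge; apply/negP => leiAv.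
  have : #|A| <= #|A :\ v|.
    rewrite -(nth_index set0 Avs); apply: (sorted_leq_nth leT_tr) => //.
    - by move=> x /=.
    - by rewrite inE index_mem.
  by rewrite leqNgt (proper_card (properD1 vA)).
rewrite (nth_map set0) // -/A -map_take big_map bigcup_seq.
exists [set completion K A :\ v | v in A]; split.
(* The first set comes before A, which forces A to be non-empty. *)
- have /earlierP[v vA _] : nth set0 s 0 \in take i s.
    by rewrite -(nth_take _ i_gt0) mem_nth // size_take ltis.
  by apply/set0Pn; exists (completion K A :\ v); apply: imset_f.
- apply/subsetP=> _ /imsetP[v vA ->]; apply: max_proper_face_setD1.
  exact: (subsetP (sub_completion _ _)).
apply/setP=> G; rewrite inE powersetE; apply/andP/bigcupP => [[sGA] |].
  case/bigcupP=> B Btake; rewrite powersetE => sGB.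
  have BI : B \in I by rewrite -sI (mem_take Btake).
  have [v vA vB] := earlierP B Btake.
  exists (completion K A :\ v); first exact: imset_f.
  rewrite powersetE subsetD1 sGA; apply: contra vB => /(subsetP sGB).
  by rewrite (mem_completion idealI AI BI vA).
case=> _ /imsetP[v vA ->]; rewrite powersetE => sGAv; split.
  exact: subset_trans sGAv (subsetDl _ _).
apply/bigcupP; exists (A :\ v); first exact: setD1_earlier.
by rewrite powersetE (subset_trans sGAv) // completion_setD1.
Qed.

Lemma shellable_squeezed K I :
  transversal_ideal K I -> shellable (squeezed K I).
Proof.
move=> idealI; split.
- exact: simplicial_complex_squeezed idealI.
- exact: pure_squeezed idealI.
set s := sort (relpre (fun A : {set T} => #|A|) leq) (enum I).
have sI : s =i I by move=> A; rewrite mem_sort mem_enum.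
have uniq_s : uniq s by rewrite sort_uniq enum_uniq.
exists (map (completion K) s); split.
- rewrite map_inj_in_uniq // => A B; rewrite !sI.
  exact: (completion_inj idealI).
- move=> F; rewrite (facets_squeezed idealI).
  apply/mapP/imsetP => -[A As ->]; exists A => //; first by rewrite -sI.
  by rewrite sI.
- apply: (shelling_squeezed idealI) => //.
  by apply: sort_sorted => A B; apply: leq_total.
Qed.

End Squeezed.

(** * Supports of color-squarefree monomials *)

Section Supports.
Variables (d : nat) (m : 'I_d -> nat).
Implicit Types (u : {cmonom var m}) (x : var m).
Arguments vert_of_var {d m} x.

Definition support u : {set vert m} := vert_of_var @: [set x | 0 < u x].

Definition support_ideal (U : {fset {cmonom var m}}) : {set {set vert m}} :=
  [set A in [seq support u | u <- enum_fset U]].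

Lemma support_idealP U A :
  reflect (exists2 u, u \in U & A = support u) (A \in support_ideal U).
Proof. by rewrite inE; apply: mapP. Qed.

Lemma vert_of_var_inj : injective (@vert_of_var d m).
Proof.
move=> [i j] [i' j'] eqv; have /= eqi := congr1 tag eqv; subst i'.
have /eqP := eqv; rewrite eq_Tagged /= => /eqP/(congr1 val) /= eqj.
by congr (Tagged _ _); apply: val_inj.
Qed.

Lemma vert_of_var_neq_last x i : vert_of_var x != last_vert m i.
Proof.
case: x => [k j]; apply/eqP => eqv; have /= eqk := congr1 tag eqv; subst k.
have /eqP := eqv; rewrite eq_Tagged /= => /eqP/(congr1 val) /= jE.
by have := ltn_ord j; rewrite jE ltnn.
Qed.

Lemma bal_facetE u :
  bal_facet u = completion tag (last_vert m) [set: 'I_d] (support u).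
Proof.
suff missE : [set i | [forall x, (0 < u x) ==> (color x != i)]]
    = [set: 'I_d] :\: tag @: support u by rewrite /bal_facet missE.
apply/setP=> i; rewrite !inE andbT; apply/forallP/idP => [noi | noi x].
  apply/imsetP=> -[_ /imsetP[x /[!inE] ux ->] iE].
  by have := noi x; rewrite ux iE eqxx.
apply/implyP=> ux; apply/eqP=> xi; case/imsetP: noi.
by exists (vert_of_var x); first by apply: imset_f; rewrite inE.
Qed.

Lemma bal_complexE U :
  bal_complex U = squeezed tag (last_vert m) [set: 'I_d] (support_ideal U).
Proof.
apply/setP=> G; rewrite inE; apply/hasP/squeezedP => [[u uU] |].
  rewrite bal_facetE => sGu; exists (support u) => //.
  by apply/support_idealP; exists u.
by case=> _ /support_idealP[u uU ->] sGu; exists u; rewrite ?bal_facetE.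
Qed.

(** Exponents being at most 1, dividing by x removes x from the support: this is
    how closure under divisors becomes closure under removal of an element. *)
Lemma support_setD1 u x : color_squarefree u -> 0 < u x ->
  divides (divcm u (ucm x)) u /\
  support (divcm u (ucm x)) = support u :\ vert_of_var x.
Proof.
move=> [sqf _] ux; split.
  exists (ucm x); apply/eqP/cmP=> y; rewrite mulcmE divcmE ucmE subnK //.
  by case: eqP => // <-.
have divE y : (0 < divcm u (ucm x) y) = (y != x) && (0 < u y).
  rewrite divcmE ucmE eq_sym; case: eqP => [->|_]; last by rewrite subn0.
  by rewrite subn_gt0 ltnNge sqf.
apply/setP=> v; apply/imsetP/setD1P => [[y] | [vx /imsetP[y]]].
  rewrite inE divE => /andP[yx uy] ->.
  by rewrite (inj_eq vert_of_var_inj) yx imset_f // inE.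
rewrite inE => uy vE; exists y => //.
by rewrite inE divE uy -(inj_eq vert_of_var_inj) -vE vx.
Qed.

Lemma transversal_support_ideal U : cs_order_ideal U ->
  transversal_ideal tag (last_vert m) [set: 'I_d] (support_ideal U).
Proof.
case=> csU clU oneU _; split=> [|_ /support_idealP[u uU ->]
  |_ /support_idealP[u uU ->]|_ /support_idealP[u uU ->] i].
- by apply/set0Pn; exists (support mone); apply/support_idealP; exists mone.
- move=> _ /imsetP[x ux ->]; rewrite inE in ux.
  have [dvd <-] := support_setD1 (csU _ uU) ux.
  by apply/support_idealP; exists (divcm u (ucm x)) => //; apply: clU dvd.
- split; last exact: subsetT.
  move=> _ _ /imsetP[x ux ->] /imsetP[y uy ->] /= eqc.
  rewrite !inE in ux uy.
  by congr vert_of_var; apply: (csU _ uU).2.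
- by apply/imsetP=> -[x _ /eqP]; rewrite eq_sym (negPf (vert_of_var_neq_last _ _)).
Qed.

End Supports.

Theorem theorem3p8 (d : nat) (m : 'I_d -> nat) (U : {fset {cmonom (var m)}})
    (d_ge1 : 1 <= d) (hU : cs_order_ideal U) :
  [/\ vertex_decomposable (bal_complex U),
      shellable (bal_complex U),
      (forall i, m i = 0) -> is_simplex (d - 1) (bal_complex U)
    & forall i, 1 <= m i -> shedding_vertex (bal_complex U) (first_vert m i)].
Proof.
have [csU _ oneU varU] := hU.
have lastK : cancel (last_vert m) tag by [].
have idealU := transversal_support_ideal hU.
split.
- by rewrite bal_complexE; apply: vertex_decomposable_squeezed.
- by rewrite bal_complexE; apply: shellable_squeezed.
- move=> m0; exists (bal_facet (mone : {cmonom var m})).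
    by rewrite (card_bal_facet (csU _ oneU)) subn1 prednK.
  have all_one (u : {cmonom var m}) : u = mone.
    by apply/eqP/cmP => -[i j]; have := leq_ltn_trans (leq0n j) (ltn_ord j); rewrite m0.
  apply/setP=> G; rewrite inE powersetE; apply/hasP/idP => [[u _] | sG].
    by rewrite (all_one u).
  by exists mone.
- move=> i mi_gt0; rewrite bal_complexE.
  pose x : var m := Tagged (fun i => 'I_(m i)) (Ordinal mi_gt0).
  apply: (shedding_vertex_squeezed lastK idealU (A := support (ucm x))).
    by apply/support_idealP; exists (ucm x); first exact: varU.
  apply/imsetP; exists x; first by rewrite inE ucmE eqxx.
  by congr (Tagged _ _); apply: val_inj.
Qed.
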